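(* If $T$ is a tree such that $\operatorname{svs}(T)\ge 2$, then $\operatorname{svs}(T)\le \mathfrak{H}(T)$.
   Context: A weak homomorphism $f:G\to H$ is a map $f:V(G)\to V(H)$ such that for every edge $uv\in E(G)$, either $f(u)f(v)\in E(H)$ or $f(u)=f(v)$; it is surjective if $f(V(G))=V(H)$. For weak homomorphisms $f,g:G\to H$, $m_G(f,g)=\min\{d_H(f(u),g(u))\mid u\in V(G)\}$. For a connected graph $H$, the strong vertex span is $\operatorname{svs}(H)=\max\{m_P(f,g)\mid P \text{ is a path and } f,g:P\to H \text{ are surjective weak homomorphisms}\}$. For a vertex $v$ of a tree $T$, the components of $T-\{v\}$ are its maximal connected subgraphs; for such a component $C(v)$, $\operatorname{reach}(C(v))=\max\{d(v,u)\mid u\in V(C(v))\cup\{v\}\}$. Denote the components of $T-\{v\}$ by $C_1(v),\dots,C_{\deg(v)}(v)$ with $\operatorname{reach}(C_i(v))\ge\operatorname{reach}(C_{i+1}(v))$. The triod size of $v$ is $\eta(v)=\operatorname{reach}(C_3(v))$ if $\deg(v)\ge 3$ and $\eta(v)=0$ if $\deg(v)\le 2$; the triod size of $T$ is $\mathfrak{H}(T)=\max\{\eta(v)\mid v\in V(T)\}$. *)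

(* Defs.v *)
From mathcomp Require Import all_boot.
From mathcomp Require Import boolp.
From mathcomp Require classical_sets.

Set Implicit Arguments.
Unset Strict Implicit.
Unset Printing Implicit Defensive.

Record sgraph := SGraph {
  vertex :> finType;
  edge : rel vertex;
  edge_sym : symmetric edge;
  edge_irrefl : irreflexive edge }.

Section Graph.
Variable G : sgraph.
Implicit Types (x y u v : G) (A C : {set G}).

Definition deg v : nat := #|[set u | edge v u]|.

(* Length of a shortest walk from u to v; a shortest walk has fewer than #|G|
   edges, so the bounded search is exhaustive. The value is #|G| when u and v
   are not connected. *)
Definition dist u v : nat :=
  find (fun n => [exists p : n.-tuple G, path (@edge G) u p && (last u p == v)])
       (iota 0 #|G|).

(* The subgraph induced on A is connected; the empty graph is not. *)
Definition connected_set A : bool :=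
  (A != set0) &&
  [forall x in A, forall y in A,
     connect [rel a b | [&& a \in A, b \in A & edge a b]] x y].

Definition connected : bool := connected_set [set: G].

Definition acyclic : Prop :=
  forall c : seq G, 2 < size c -> ~~ ucycleb (@edge G) c.

Definition tree : Prop := connected /\ acyclic.

(* A maximal connected subgraph is induced, so the components of T - {v} are
   represented by their vertex sets. *)
Definition components v : {set {set G}} :=
  [set C | maxset [pred A : {set G} | (v \notin A) && connected_set A] C].

Definition reach v C : nat := \max_(u in (v |: C)) dist v u.

(* Reaches of the components of G - {v}, in nonincreasing order, so that
   reach (C_3(v)) is the entry of index 2. *)
Definition reaches v : seq nat :=
  sort geq [seq reach v C | C <- enum (components v)].

Definition vertex_triod_size v : nat :=
  if 3 <= deg v then nth 0 (reaches v) 2 else 0.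

Definition triod_size : nat := \max_(v : G) vertex_triod_size v.

End Graph.

Definition weak_hom (G H : sgraph) (f : G -> H) : Prop :=
  forall u v : G, edge u v -> edge (f u) (f v) \/ f u = f v.

Definition surjective (A B : Type) (f : A -> B) : Prop :=
  forall y, exists x, f x = y.

(* The neutral value #|H| bounds all values of dist, so for nonempty G this is
   the minimum over the vertices of G. *)
Definition min_dist (G H : sgraph) (f g : G -> H) : nat :=
  \big[minn/#|H|]_(u : G) dist (f u) (g u).

Section PathGraph.
Variable n : nat.

Definition path_edge : rel 'I_n.+1 :=
  fun i j => (i.+1 == j :> nat) || (j.+1 == i :> nat).

Fact path_edge_sym : symmetric path_edge.
Proof. by move=> i j; exact: orbC. Qed.

Fact path_edge_irrefl : irreflexive path_edge.
Proof. by move=> i; rewrite /path_edge orbb eqn_leq ltnn. Qed.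

(* The path with n edges. *)
Definition path_graph : sgraph := SGraph path_edge_sym path_edge_irrefl.

End PathGraph.

Definition svs_value (H : sgraph) (k : nat) : Prop :=
  exists (n : nat) (f g : path_graph n -> H),
    [/\ weak_hom f, surjective f, weak_hom g, surjective g
      & min_dist f g = k].

Definition is_max (S : nat -> Prop) (k : nat) : Prop :=
  S k /\ forall j, S j -> j <= k.

(* The maximum of S; 0 is a junk value when S has no maximum. *)
Definition max_of (S : nat -> Prop) : nat :=
  classical_sets.xget 0 (is_max S).

Definition svs (H : sgraph) : nat := max_of (svs_value H).

Lemma covering_walk (H : sgraph) (x : H) (s : seq H) :
  connected H -> exists p, path (@edge H) x p /\ {subset s <= x :: p}.
Proof.
case/andP=> _ /forallP cH; elim: s x => [|y s IHs] x; first by exists [::].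
have /implyP/(_ (in_setT _))/forallP/(_ y)/implyP/(_ (in_setT _)) := cH x.
case/connectP=> p pathp ->; have [q [pathq sq]] := IHs (last x p).
exists (p ++ q); split.
  rewrite cat_path pathq andbT; apply: sub_path pathp.
  by move=> a b /and3P[].
have sub : {subset last x p :: q <= x :: p ++ q}.
  move=> z; rewrite -cat_cons mem_cat inE => /orP[/eqP->|->]; last by rewrite orbT.
  by rewrite mem_last.
by move=> z; rewrite inE => /orP[/eqP->|/sq/sub//]; rewrite sub ?mem_head.
Qed.

Lemma svs_value_ex (H : sgraph) : connected H -> exists k, svs_value H k.
Proof.
move=> cH; have /andP[/set0Pn[x _] _] := cH.
have [p [pathp sp]] := covering_walk x (enum H) cH.
pose f (i : path_graph (size p)) := nth x (x :: p) i.
have fS (i j : path_graph (size p)) : i.+1 = j :> nat -> edge (f i) (f j).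
  move=> ij; rewrite /f -ij; apply/pathP => //.
  by rewrite -ltnS ij ltn_ord.
have wf : weak_hom f.
  move=> i j /orP[/eqP ij|/eqP ji]; left; first exact: fS.
  by rewrite edge_sym; apply: fS.
have sf : surjective f.
  move=> y; have ys : y \in x :: p by apply: sp; rewrite mem_enum.
  have ltp : index y (x :: p) < (size p).+1 by rewrite -[ltnRHS]/(size (x :: p)) index_mem.
  by exists (Ordinal ltp); rewrite /f nth_index.
by exists (min_dist f f), (size p), f, f.
Qed.

Lemma svs_value_bound (H : sgraph) k : svs_value H k -> k <= #|H|.
Proof.
case=> n [f [g [_ _ _ _ <-]]]; apply: (big_ind (fun m => m <= #|H|)) => //.
  by move=> a b la _; rewrite geq_min la.
by move=> i _; rewrite -[leqRHS](size_iota 0) find_size.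
Qed.

Lemma svs_is_max (H : sgraph) : connected H -> is_max (svs_value H) (svs H).
Proof.
move=> cH; have [k0 k0P] := svs_value_ex cH.
pose P k := `[< svs_value H k >].
have exP : exists k, P k by exists k0; apply/asboolP.
have bP k : P k -> k <= #|H| by move/asboolP/svs_value_bound.
rewrite /svs /max_of; case: classical_sets.xgetP => [k _ //|noMax].
case: (ex_maxnP exP bP) => k /asboolP kP kmax; case: (noMax k).
by split=> // j /asboolP; apply: kmax.
Qed.

(* Main.v *)
(* Let D be a longest path of T and suppose that the triod size of T is less
   than k = svs T. By maximality of D every branch hanging off D has depth less
   than k, so two walkers at distance at least k cannot have the same projection
   on D when one of them is on D. The projection of a walker moves only along
   edges of D, so the projections of the two walkers can never start to coincide;
   nor can they be exchanged in one step, since the walkers would then be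
   adjacent, against k >= 2. Hence their order along D never changes, while the
   first walker visits both ends of D. *)
Require Import Defs.
From mathcomp Require Import all_boot zify.

Set Implicit Arguments.
Unset Strict Implicit.
Unset Printing Implicit Defensive.

(** Serves to bound [reach (C_3(v))] from below: it is enough to exhibit three components of reach
    at least k, wherever the sorting places them. *)
Lemma nth_sort_geq (s : seq nat) i k :
  i < count (leq k) s -> k <= nth 0 (sort geq s) i.
Proof.
have geq_tr : transitive geq by move=> a b c /= ba ac; exact: leq_trans ac ba.
have : sorted geq (sort geq s) by apply: sort_sorted => a b; exact: leq_total.
rewrite -(count_sort geq) ; elim: (sort geq s) i => [|a t IHt] i //= path_t.
have := order_path_min geq_tr path_t; move/allP=> amax.
case: i => [|i] /=.
  case: (leqP k a) => // ltak; rewrite ltnNge leqn0 -lt0n -has_count.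
  by move/hasP=> [b /amax /= ba kb]; rewrite leqNgt (leq_ltn_trans ba ltak) in kb.
move=> lti; apply: IHt; first exact: path_sorted path_t.
by case: (k <= a) lti => //; rewrite add0n => /ltnW.
Qed.

(** * Distances, components and triods in a tree *)

Section Graph.
Variable G : sgraph.
Implicit Types (u v x y z : G) (p q : seq G).

Lemma dist_path u p : path (@edge G) u p -> dist u (last u p) <= size p.
Proof.
move=> up; rewrite /dist; set P := (X in find X).
(* A walk too long for the search range is harmless, since [dist] never exceeds the number of
   vertices. *)
have [ltp|] := ltnP (size p) #|G|; last first.
  by apply: leq_trans; rewrite -[leqRHS](size_iota 0) find_size.
rewrite leqNgt; apply/negP => /(before_find 0); rewrite nth_iota // add0n /P.
by move/existsP; case; exists (in_tuple p); rewrite up eqxx.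
Qed.

Lemma path_of_connect (e : rel G) x y :
  connect e x y -> exists p, [/\ path e x p, uniq (x :: p) & last x p = y].
Proof. by case/connectP=> p /shortenP[q eq uq _] ->; exists q. Qed.

Lemma connect_edge x y : connected G -> connect (@edge G) x y.
Proof.
case/andP=> _ /forallP/(_ x)/implyP/(_ (in_setT _)).
move/forallP/(_ y)/implyP/(_ (in_setT _)).
by apply: connect_sub => a b /and3P[_ _ /connect1].
Qed.

(** A simple path from u to v has fewer than [#|G|] edges, so the search in [dist] succeeds and does
    not return its default value. *)
Lemma dist_attained u v : connected G ->
  exists p, [/\ path (@edge G) u p, last u p = v & size p = dist u v].
Proof.
move=> cG; have [q [uq uniq_q lq]] := path_of_connect (connect_edge u v cG).
have sq : size q < #|G|.
  by have := max_card (mem (u :: q)); rewrite (card_uniqP uniq_q).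
rewrite /dist; set P := (X in find X).
have hasP' : has P (iota 0 #|G|).
  apply/hasP; exists (size q); first by rewrite mem_iota.
  by apply/existsP; exists (in_tuple q); rewrite uq lq eqxx.
have := nth_find 0 hasP'; rewrite nth_iota; last by rewrite -[ltnRHS](size_iota 0) -has_find.
by case/existsP=> p /andP[up /eqP lp]; exists p; rewrite size_tuple.
Qed.

Lemma rev_path_edge x p :
  path (@edge G) x p -> path (@edge G) (last x p) (rev (belast x p)).
Proof.
by rewrite rev_path => xp; rewrite (eq_path (e' := @edge G)) // => a b; exact: edge_sym.
Qed.

Lemma last_rev_belast x p : last (last x p) (rev (belast x p)) = x.
Proof. by case: p => //= y p; rewrite rev_cons last_rcons. Qed.

Lemma dist_path_rev u p : path (@edge G) u p -> dist (last u p) u <= size p.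
Proof.
by move/rev_path_edge/dist_path; rewrite last_rev_belast size_rev size_belast.
Qed.

(** Deletion of v within the same vertex type: v becomes isolated, but [connect] still relates it to
    itself. *)
Definition avoiding v x y := [&& x != v, y != v & edge x y].
Arguments avoiding v x y /.

Lemma avoiding_sym v : connect_sym (avoiding v).
Proof. by apply: sym_connect_sym => a b /=; rewrite edge_sym andbCA. Qed.

Lemma connect_avoiding v x p :
  path (@edge G) x p -> v \notin x :: p -> connect (avoiding v) x (last x p).
Proof.
move=> xp vp; apply/connectP; exists p => //.
elim: p x xp vp => //= y p IHp x /andP[xy yp].
rewrite !inE !negb_or => /and3P[vx vy vp].
by rewrite IHp ?inE ?negb_or ?vy // andbT /= xy eq_sym vx eq_sym vy.
Qed.

Definition component v z : {set G} := [set y | connect (avoiding v) z y].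

Lemma component_in v z : z != v -> component v z \in components v.
Proof.
move=> zv; rewrite inE; apply/maxsetP; split=> [|A /andP[vA /andP[_ cA]] sCA].
  apply/andP; split.
    rewrite inE avoiding_sym; apply/negP => /connectP[[|a p] /=].
      by move=> _ /eqP; rewrite (negPf zv).
    by rewrite eqxx.
  apply/andP; split; first by apply/set0Pn; exists z; rewrite inE connect0.
  apply/forallP=> x; apply/implyP; rewrite inE => zx.
  apply/forallP=> y; apply/implyP; rewrite inE => zy.
  have: connect (avoiding v) x y.
    by apply: connect_trans zy; rewrite avoiding_sym.
  (* Every vertex of the walk is reachable from z, so the walk stays inside the component, as
     [connected_set] demands. *)
  case/connectP=> p xp ->{y zy}; elim: p x xp zx => [|a p IHp] x //=.
  case/andP=> xa ap zx; have za : connect (avoiding v) z a.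
    by apply: connect_trans zx (connect1 _).
  apply: connect_trans (IHp _ ap za); apply: connect1 => /=.
  by rewrite !inE zx za; case/and3P: xa.
(* Maximality: walks inside a connected set A that misses v also avoid v, so all of A is reachable
   from z. *)
apply/eqP; rewrite eqEsubset sCA andbT; apply/subsetP => y yA.
have zA : z \in A by apply: (subsetP sCA); rewrite inE connect0.
move: cA => /forallP/(_ z)/implyP/(_ zA)/forallP/(_ y)/implyP/(_ yA).
rewrite inE; apply: connect_sub => a b /and3P[aA bA ab]; apply: connect1 => /=.
by rewrite ab andbT; apply/andP; split; apply: contraNneq vA => <-.
Qed.

Lemma dist_le_reach v (C : {set G}) u : u \in C -> dist v u <= reach v C.
Proof.
by move=> uC; apply: (@leq_bigmax_cond _ _ (dist v)); rewrite inE uC orbT.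
Qed.

Hypothesis treeG : tree G.

(** A simple path from z to w avoiding x would close up through x to a cycle with at least three
    vertices. *)
Lemma neighbours_separated x z w :
  edge x z -> edge x w -> z != w -> ~~ connect (avoiding x) z w.
Proof.
move=> xz xw zw; apply/negP=> /path_of_connect[p [zp up lp]].
have xp : x \notin z :: p.
  rewrite inE negb_or; apply/andP; split.
    by apply/eqP=> xz'; rewrite xz' edge_irrefl in xz.
  elim: p z {xz zw up lp} zp => //= a p IHp z /andP[/and3P[_ ax _] ap].
  by rewrite inE negb_or eq_sym ax (IHp a).
have := treeG.2 (x :: z :: p); rewrite /ucycleb.
have -> : 2 < size (x :: z :: p) by case: p lp {zp up xp} => //= zw'; rewrite zw' eqxx in zw.
move=> /(_ isT)/negP; apply.
rewrite cons_uniq xp up !andbT /= rcons_path xz lp [edge w x]edge_sym xw andbT /=.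
by apply: sub_path zp => a b /and3P[].
Qed.

(** Where the paths first diverge, their next vertices are distinct neighbours of x, yet the two
    tails join them through the common end without meeting x. *)
Lemma tree_path_unique x p q :
  path (@edge G) x p -> path (@edge G) x q -> uniq (x :: p) -> uniq (x :: q) ->
  last x p = last x q -> p = q.
Proof.
elim: p x q => [|z p IHp] x [|w q] //.
- by move=> _ _ _ /andP[xq _] /= lq; rewrite lq mem_last in xq.
- by move=> _ _ /andP[xq _] _ /= lq; rewrite -lq mem_last in xq.
move=> /= /andP[xz zp] /andP[xw wq] /andP[xnp up] /andP[xnq uq] lpq.
have [zw|zw] := eqVneq z w; first by rewrite -zw in wq uq lpq *; rewrite (IHp z q).
case/negP: (neighbours_separated xz xw zw).
apply: connect_trans (connect_avoiding zp xnp) _.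
by rewrite lpq avoiding_sym connect_avoiding.
Qed.

Lemma tree_dist x p :
  path (@edge G) x p -> uniq (x :: p) -> dist x (last x p) = size p.
Proof.
move=> xp up; apply/eqP; rewrite eqn_leq dist_path //=.
have [q [xq lq <-]] := dist_attained x (last x p) treeG.1.
case: (shortenP xq) lq => r xr ur subr lr.
rewrite (tree_path_unique xp xr) //.
by apply: uniq_leq_size subr; case/andP: ur.
Qed.

Lemma reach_component v z p :
  path (@edge G) v (z :: p) -> uniq (v :: z :: p) ->
  (size p).+1 <= reach v (component v z).
Proof.
move=> vp up; rewrite -[X in X <= _](tree_dist vp up); apply: dist_le_reach.
rewrite inE; apply: connect_avoiding; first by case/andP: vp.
by case/andP: up.
Qed.

(** The first vertices of the three paths are distinct neighbours of v, hence lie in three different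
    components, each containing the rest of its path. *)
Lemma triod_le_triod_size v k p1 p2 p3 :
  path (@edge G) v p1 -> uniq (v :: p1) -> k <= size p1 ->
  path (@edge G) v p2 -> uniq (v :: p2) -> k <= size p2 ->
  path (@edge G) v p3 -> uniq (v :: p3) -> k <= size p3 ->
  uniq (p1 ++ p2 ++ p3) -> k <= triod_size G.
Proof.
case: k => [//|k].
case: p1 => // z1 p1; case: p2 => // z2 p2; case: p3 => // z3 p3.
move=> vp1 u1 k1 vp2 u2 k2 vp3 u3 k3 u123.
have uz : uniq [:: z1; z2; z3].
  apply: subseq_uniq u123; apply: (@cat_subseq _ [:: z1] [:: z2; z3]).
    by rewrite sub1seq mem_head.
  by apply: (@cat_subseq _ [:: z2] [:: z3]); rewrite sub1seq mem_head.
have e1 : edge v z1 by case/andP: vp1.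
have e2 : edge v z2 by case/andP: vp2.
have e3 : edge v z3 by case/andP: vp3.
apply: leq_trans (_ : _ <= vertex_triod_size v) (leq_bigmax _).
have neq z : edge v z -> z != v by move=> vz; apply/eqP=> zv; rewrite zv edge_irrefl in vz.
have compI : {in [:: z1; z2; z3] &, injective (component v)}.
  have ez z : z \in [:: z1; z2; z3] -> edge v z by rewrite !inE => /or3P[] /eqP->.
  move=> a b /ez va /ez vb Cab; apply/eqP; apply/negPn/negP => ab.
  case/negP: (neighbours_separated va vb ab).
  by have := in_set (connect (avoiding v) b) b; rewrite connect0 -/(component v b) -Cab inE.
have card3 (S : finType) (s : seq S) (A : {set S}) : uniq s -> {subset s <= A} -> size s <= #|A|.
  by move=> us sA; rewrite -(card_uniqP us); apply/subset_leq_card/subsetP.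
have deg3 : 3 <= deg v.
  by apply: (card3 _ [:: z1; z2; z3]) => // z; rewrite !inE => /or3P[] /eqP->.
rewrite /vertex_triod_size deg3.
apply: nth_sort_geq; rewrite count_map -size_filter.
apply: leq_trans (uniq_leq_size (s1 := map (component v) [:: z1; z2; z3]) _ _) => //.
  by rewrite map_inj_in_uniq.
move=> C; rewrite /= !in_cons in_nil orbF mem_filter mem_enum.
by case/or3P=> /eqP->; rewrite /= component_in ?neq // andbT;
  [apply: leq_trans k1 _|apply: leq_trans k2 _|apply: leq_trans k3 _]; exact: reach_component.
Qed.

End Graph.

(** * Projection of a tree onto a path D *)

Section LongestPath.
Variables (G : sgraph) (D : seq G).
Hypotheses (treeG : tree G) (pathD : sorted (@edge G) D) (uniqD : uniq D).
Implicit Types (u v x y z : G) (p q s : seq G).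

Lemma sorted_edge_rev s : sorted (@edge G) (rev s) = sorted (@edge G) s.
Proof. by rewrite rev_sorted; case: s => //= x s; apply: eq_path => a b; exact: edge_sym. Qed.

Lemma sorted_cat_cons (e : rel G) s x t :
  sorted e (s ++ x :: t) = sorted e (rcons s x) && path e x t.
Proof. by case: s => //= a s; rewrite cat_path rcons_path /= andbA. Qed.

Lemma subpath x y : x \in D -> index x D < index y D -> y \in D ->
  exists r, [/\ path (@edge G) x r, uniq (x :: r), last x r = y,
    {subset r <= D} & size r = index y D - index x D].
Proof.
move: pathD uniqD => + + xD; case/splitPr: xD => s t.
rewrite sorted_cat_cons cat_uniq => /andP[_ xt] /and3P[_ xs uxt] ltxy.
rewrite mem_cat => yD.
have ix : index x (s ++ x :: t) = size s.
  rewrite index_cat (negPf (_ : x \notin s)) ?index_head ?addn0 //.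
  by apply: contra xs => xs; apply/hasP; exists x; rewrite ?mem_head.
have ys : y \notin s.
  apply: contraL ltxy => ys; rewrite ix index_cat ys -leqNgt ltnW //.
  by rewrite index_mem.
have xy : x != y by apply: contraTneq ltxy => ->; rewrite ltnn.
have yt : y \in t by move: yD; rewrite (negPf ys) inE eq_sym (negPf xy).
rewrite ix index_cat (negPf ys) addKn /= (negPf xy).
case/splitPr: yt xt uxt {xs ltxy yD ix} => t1 t2.
rewrite -cat_rcons cat_path -cat_cons cat_uniq => /andP[xt1 _] /andP[uxt1 _].
exists (rcons t1 y); split=> //.
- by rewrite last_rcons.
- by move=> z zt; rewrite mem_cat inE mem_cat zt !orbT.
have yt1 : y \notin t1 by move: uxt1; rewrite /= rcons_uniq => /and3P[].
by rewrite size_rcons index_cat mem_rcons mem_head -cats1 index_cat (negPf yt1) /= eqxx addn0.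
Qed.

(** The edge and the segment of D from x to y are simple paths with the same ends, so they agree. *)
Lemma index_edge x y : x \in D -> y \in D -> edge x y ->
  index x D < index y D -> index y D = (index x D).+1.
Proof.
move=> xD yD xy ltxy; have [r [xr ur lr _ sr]] := subpath xD ltxy yD.
have xy' : uniq [:: x; y].
  by rewrite /= inE !andbT; apply: contraTneq xy => ->; rewrite edge_irrefl.
have rE : r = [:: y] by apply: (tree_path_unique treeG xr) => //=; rewrite xy.
by rewrite -(subnK (ltnW ltxy)) -sr rE.
Qed.

(** In a tree an edge with both ends in D is an edge of D, so this relation deletes the edges of D;
    its classes are the branches hanging off D. *)
Definition off_path x y := edge x y && ~~ ((x \in D) && (y \in D)).
Arguments off_path x y /.

Lemma off_path_sym : connect_sym off_path.
Proof. by apply: sym_connect_sym => a b /=; rewrite edge_sym [(b \in D) && _]andbC. Qed.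

Lemma off_path_edge x p : path off_path x p -> path (@edge G) x p.
Proof. by apply: sub_path => a b /andP[]. Qed.

(** Otherwise the simple path off D would coincide with a segment of D, whose first edge has both
    ends in D. *)
Lemma off_path_inj x y :
  x \in D -> y \in D -> connect off_path x y -> x = y.
Proof.
move=> xD yD; wlog ltxy : x y xD yD / index x D < index y D.
  move=> wl cxy; have [lt|lt|eq] := ltngtP (index x D) (index y D).
  - exact: wl.
  - by apply/esym/wl => //; rewrite off_path_sym.
  by rewrite -(nth_index x xD) eq nth_index.
case/path_of_connect=> q [xq uq lq].
have [r [xr ur lr rD _]] := subpath xD ltxy yD.
have rq : q = r by apply: (tree_path_unique treeG (off_path_edge xq)); rewrite ?lq.
rewrite -rq in rD; case: q xq lq rD {uq rq} => [_ //|b q /= /andP[/andP[_ bD] _] _].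
by move/(_ b); rewrite mem_head => /(_ isT) bD'; rewrite xD bD' in bD.
Qed.

(** The position along D of the projection of x, that is, of the vertex of D at which the branch
    containing x is attached. *)
Definition foot_index x : nat := find (connect off_path x) D.

Lemma foot_indexE x v : v \in D -> connect off_path x v -> foot_index x = index v D.
Proof.
move=> vD xv; have hasD : has (connect off_path x) D by apply/hasP; exists v.
have ltD : foot_index x < size D by rewrite -has_find.
have /(off_path_inj _ vD) <- : connect off_path (nth v D (foot_index x)) v.
- by apply: connect_trans xv; rewrite off_path_sym nth_find.
- by rewrite index_uniq.
by rewrite mem_nth.
Qed.

Lemma foot_index_mem v : v \in D -> foot_index v = index v D.
Proof. by move=> vD; apply: foot_indexE. Qed.

Lemma foot_ex x : D != [::] ->
  exists v, [/\ v \in D, connect off_path x v & foot_index x = index v D].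
Proof.
case eD : D => [//|a p'] _; have aD : a \in D by rewrite eD mem_head.
rewrite -eD; suff [v vD xv] : exists2 v, v \in D & connect off_path x v.
  by exists v; split=> //; apply: foot_indexE.
(* A walk from x to an end of D uses only edges off D until it first meets D. *)
have /connectP[q xq la] := connect_edge x a treeG.1.
rewrite {}la {eD} in aD; elim: q x xq aD => [|b q IHq] x /=; first by exists x.
case/andP=> xb bq lD; have [v vD bv] := IHq b bq lD.
have [xD|xD] := boolP (x \in D); first by exists x.
by exists v => //; apply: connect_trans bv; apply: connect1; rewrite /= xb (negPf xD).
Qed.

Lemma foot_index_edge x y : edge x y ->
  foot_index x = foot_index y \/
  [/\ x \in D, y \in D, foot_index x <= (foot_index y).+1
     & foot_index y <= (foot_index x).+1].
Proof.
move=> xy; have [/andP[xD yD]|offxy] := boolP ((x \in D) && (y \in D)); last first.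
  left; apply: eq_find => v; apply/idP/idP; apply: connect_trans.
    by rewrite off_path_sym connect1 //= xy.
  by rewrite connect1 //= xy.
right; split=> //; rewrite !foot_index_mem //.
  by have [|lt] := leqP (index x D) (index y D); [exact: leqW|rewrite (index_edge yD) // edge_sym].
by have [|lt] := leqP (index y D) (index x D); [exact: leqW|rewrite (index_edge xD)].
Qed.

Hypothesis maxD : forall s, sorted (@edge G) s -> uniq s -> size s <= size D.

(* By maximality, a branch of length k at v leaves at least k vertices of D on
   either side of v, so that v is the centre of a triod of size k. *)
Lemma branch_lt k v x : triod_size G < k -> v \in D -> connect off_path v x ->
  dist v x < k /\ dist x v < k.
Proof.
move=> triodk vD /path_of_connect[q [vq uq lq]].
have qD z : z \in q -> z \notin D.
  move=> zq; apply/negP=> zD; have vz := off_path_inj vD zD.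
  case/andP: uq; rewrite vz ?zq //.
  by apply: (path_connect vq); rewrite inE zq orbT.
have evq := off_path_edge vq.
have uq' : uniq q by case/andP: uq.
suff ltq : size q < k.
  by rewrite -lq; split; apply: leq_ltn_trans ltq; [exact: dist_path|exact: dist_path_rev].
rewrite ltnNge; apply/negP=> lekq; move: triodk; rewrite ltnNge => /negP; apply.
move: pathD uniqD maxD qD; case/splitPr: vD => A B.
rewrite sorted_cat_cons => /andP[Av vB] uAB maxAB qAB.
have uA : uniq A by move: uAB; rewrite cat_uniq => /andP[].
have uvB : uniq (v :: B) by move: uAB; rewrite cat_uniq => /and3P[].
have uvA : uniq (v :: rev A).
  move: uAB; rewrite -cat_rcons cat_uniq rcons_uniq => /andP[/andP[vA _] _].
  by rewrite /= mem_rev vA rev_uniq.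
have vA : path (@edge G) v (rev A).
  by rewrite -[path _ _ _]/(sorted _ (v :: _)) -rev_rcons sorted_edge_rev.
(* Replacing the part of D after v by q gives a competitor for the longest path; [leqA] treats the
   part before v likewise. *)
have leqB : size q <= size B.
  have := maxAB (A ++ v :: q); rewrite sorted_cat_cons Av evq !size_cat leq_add2l ltnS.
  apply=> //; rewrite cat_uniq uA uq andbT; apply/hasPn => z.
  rewrite inE => /orP[/eqP->|/qAB]; last by rewrite mem_cat negb_or => /andP[].
  by case/andP: uvA; rewrite mem_rev.
have leqA : size q <= size A.
  have := maxAB (rev q ++ v :: B); rewrite sorted_cat_cons vB andbT -rev_cons.
  rewrite sorted_edge_rev !size_cat size_rev leq_add2r.
  apply=> //; rewrite cat_uniq rev_uniq uvB uq' andbT; apply/hasPn => z.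
  rewrite inE mem_rev => /orP[/eqP->|zB]; first by case/andP: uq.
  by apply: contraL zB => /qAB; rewrite mem_cat inE !negb_or => /and3P[].
apply: (triod_le_triod_size treeG evq uq lekq vA uvA _ vB uvB).
- by rewrite size_rev (leq_trans lekq).
- exact: leq_trans leqB.
rewrite cat_uniq; apply/and3P; split=> //.
  apply/hasPn => z zAB; apply: contraTN zAB => /qAB; apply: contra.
  by rewrite !mem_cat mem_rev inE => /orP[]->; rewrite ?orbT.
have uB : uniq B by case/andP: uvB.
move: uAB; rewrite !cat_uniq rev_uniq uA uB andbT => /and3P[_ AvB _].
apply: contra AvB => /hasP[z zB zA]; apply/hasP; exists z.
  by rewrite inE zB orbT.
by rewrite -mem_rev.
Qed.

End LongestPath.

(** * Two walkers projected onto a longest path *)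

Lemma longest_path (G : sgraph) : exists D : seq G,
  [/\ sorted (@edge G) D, uniq D
    & forall s, sorted (@edge G) s -> uniq s -> size s <= size D].
Proof.
pose P n := [exists t : n.-tuple G, sorted (@edge G) t && uniq t].
have exP : exists n, P n by exists 0; apply/existsP; exists [tuple].
have bP n : P n -> n <= #|G|.
  case/existsP=> t /andP[_ ut]; rewrite -(size_tuple t) -(card_uniqP ut).
  exact: max_card.
have [n /existsP[t /andP[st ut]] maxn] := ex_maxnP exP bP.
exists t; split=> // s ss us; rewrite size_tuple; apply: maxn.
by apply/existsP; exists (in_tuple s); rewrite ss us.
Qed.

(** Comparing every vertex with [ord0] spares a choice of direction: edges are symmetric, so Q
    passes both ways along the path. *)
Lemma path_graph_invariant n (Q : path_graph n -> Prop) :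
  (forall u v, edge u v -> Q u -> Q v) -> forall u v, Q u -> Q v.
Proof.
move=> QE; suff to0 u : Q u <-> Q ord0 by move=> u v /(to0 u) Q0; apply/to0.
case: u => m; elim: m => [|m IHm] ltm.
  by rewrite (_ : Ordinal ltm = ord0 :> path_graph n) //; apply: val_inj.
have e : edge (Ordinal (ltnW ltm) : path_graph n) (Ordinal ltm).
  by rewrite /= /path_edge /= eqxx.
split=> [Qm|/(IHm (ltnW ltm))]; last exact: QE.
by apply/(IHm (ltnW ltm)); apply: QE Qm; rewrite edge_sym.
Qed.

Lemma min_dist_le (G H : sgraph) (f g : G -> H) u :
  min_dist f g <= dist (f u) (g u).
Proof.
rewrite /min_dist; elim: (index_enum _) (mem_index_enum u) => // v s IHs.
by rewrite inE big_cons geq_min => /orP[/eqP<-|/IHs->]; rewrite ?leqnn ?orbT.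
Qed.

Theorem theorem2p3 (T : sgraph) (hT : tree T) (hsvs : 2 <= svs T) :
  svs T <= triod_size T.
Proof.
have [[n [f [g [wf sf wg _ kE]]]] _] := svs_is_max hT.1.
have far t := min_dist_le f g t; rewrite kE in far.
rewrite leqNgt; apply/negP => triodk.
have [D [sD uD maxD]] := longest_path T.
have D0 : D != [::].
  by have := maxD [:: f ord0] isT isT; case: (D).
have near x v : v \in D -> foot_index D x = index v D ->
    dist v x < svs T /\ dist x v < svs T.
  move=> vD xv; have [w [wD xw xwE]] := foot_ex hT sD uD x D0.
  have -> : v = w by rewrite -(nth_index v vD) -xv xwE nth_index.
  by apply: (branch_lt hT sD uD maxD triodk wD); rewrite off_path_sym.
have feet t : foot_index D (f t) = foot_index D (g t) ->
    f t \notin D /\ g t \notin D.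
  move=> fg; split; apply/negP => inD.
    have [] := near (g t) (f t) inD; first by rewrite -fg foot_index_mem.
    by rewrite ltnNge far.
  have [] := near (f t) (g t) inD; first by rewrite fg foot_index_mem.
  by move=> _; rewrite ltnNge far.
have inv u v : edge u v -> foot_index D (f u) < foot_index D (g u) ->
    foot_index D (f v) < foot_index D (g v).
  move=> uv lt_u; have step (h : path_graph n -> T) : weak_hom h ->
      foot_index D (h u) = foot_index D (h v) \/
      [/\ edge (h u) (h v), h u \in D, h v \in D,
        foot_index D (h u) <= (foot_index D (h v)).+1
        & foot_index D (h v) <= (foot_index D (h u)).+1].
    case/(_ u v uv)=> [huv|->]; last by left.
    by have [->|[? ? ? ?]] := foot_index_edge hT sD uD huv; [left|right].
  (* If the projections coincide at v, both walkers are off D there, so neither projection moved in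
     this step, and they coincided at u already. *)
  rewrite ltnNge leq_eqVlt; apply/negP => /orP[/eqP eq_v|gt_v].
    have [fD gD] := feet v (esym eq_v).
    have [ef|[_ _ fD']] := step f wf; last by rewrite fD' in fD.
    have [eg|[_ _ gD']] := step g wg; last by rewrite gD' in gD.
    by rewrite ef eg eq_v ltnn in lt_u.
  (* A reversal in one step forces both projections to move by one and change places. Then
     [f v = g u], so [f u] and [g u] are adjacent, at distance below 2. *)
  have [ef|[fuv fu fv ? ?]] := step f wf; have [eg|[guv gu gv ? ?]] := step g wg; try lia.
  have fvgu : f v = g u.
    rewrite -(nth_index (f v) fv) -(nth_index (f v) gu) -!foot_index_mem //.
    by congr nth; lia.
  have := far u; rewrite leqNgt (leq_ltn_trans _ hsvs) //.
  by apply: (@dist_path _ (f u) [:: g u]); rewrite /= -fvgu fuv.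
case eD : D D0 => [//|a p] _.
(* When f is at the first vertex of D, the projection of g lies strictly beyond it; by invariance
   this remains so when f is at the last vertex, where nothing lies beyond. *)
have [t0 ft0] := sf a; have [t1 ft1] := sf (last a p).
have aD : a \in D by rewrite eD mem_head.
have lD : last a p \in D by rewrite eD mem_last.
have lt0 : foot_index D (f t0) < foot_index D (g t0).
  have f0 : foot_index D (f t0) = 0 by rewrite ft0 foot_index_mem // eD index_head.
  rewrite f0 lt0n; apply/eqP => g0.
  by have [|+ _] := feet t0; [rewrite f0 g0|rewrite ft0 aD].
have := path_graph_invariant inv t1 lt0.
have [w [wD _ ->]] := foot_ex hT sD uD (g t1) (D := D) ltac:(by rewrite eD).
have lt_w : index w (a :: p) < (size p).+1.
  by move: wD; rewrite -index_mem eD.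
have last_p : index (last a p) (a :: p) = size p by rewrite index_last // -eD.
by rewrite ft1 foot_index_mem // eD last_p ltnNge -ltnS lt_w.
Qed.
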